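(* Let $\mathcal{R}=\mathcal{R}(\mathcal{C},(\Delta^X)_{X\in\mathcal{X}})$ be a finite root system of type $\mathcal{C}$, where $\mathcal{C}$ is a Cartan scheme with connected Weyl groupoid $\mathcal{W}$, and let $X\in\mathcal{X}$. Given a total order on $\Delta^X_+$, the following statements are equivalent: (1) the order is associated with a reduced expression of the longest element, i.e. there is a reduced expression $w=\mathrm{id}_X s_{i_1}\cdots s_{i_m}$ of the element $w$ of maximal length in $\mathrm{Hom}(\mathcal{W},X)$ such that $\Delta^X_+=\{\beta_1<\dots<\beta_m\}$ with $\beta_j=s_{i_1}\cdots s_{i_{j-1}}(\alpha_{i_j})$ for all $1\le j\le m$; (2) the order is strongly convex; (3) the order is convex.
   Context: A Cartan scheme $\mathcal{C}=\mathcal{C}(I,\mathcal{X},(r_i)_{i\in I},(A^X)_{X\in\mathcal{X}})$ consists of a nonempty set $\mathcal{X}$, a nonempty finite set $I$, maps $r_i:\mathcal{X}\to\mathcal{X}$ with $r_i^2=\mathrm{id}$, and generalized Cartan matrices $A^X=(a^X_{ij})_{i,j\in I}$ with $a^X_{ij}=a^{r_i(X)}_{ij}$ for all $i,j,X$. Let $\{\alpha_i\}_{i\in I}$ be the canonical basis of $\mathbb{Z}^I$ and $s_i^X\in\mathrm{Aut}(\mathbb{Z}^I)$, $s_i^X(\alpha_j)=\alpha_j-a^X_{ij}\alpha_i$. The Weyl groupoid $\mathcal{W}$ has objects $\mathcal{X}$ and morphisms generated by the $s_i^X\in\mathrm{Hom}(X,r_i(X))$; it is connected if $\mathrm{Hom}(Y,X)\neq\emptyset$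 for all $X,Y$. $\mathrm{Hom}(\mathcal{W},X)=\bigcup_Y\mathrm{Hom}(Y,X)$. The notation $\mathrm{id}_Xs_{i_1}\cdots s_{i_m}$ denotes the element of $\mathrm{Hom}(\mathcal{W},X)$ given by the composition of the indicated maps, the intermediate objects being determined: the $j$-th factor goes from $r_{i_j}(X_j)$ to $X_j$, where $X_1=X$, $X_{j+1}=r_{i_j}(X_j)$ (as linear maps $s_i^{Y}=s_i^{r_i(Y)}$). The length $\ell(w)$ of $w\in\mathrm{Hom}(\mathcal{W},X)$ is the least $n$ such that $w=\mathrm{id}_Xs_{i_1}\cdots s_{i_n}$ for some $i_1,\dots,i_n$; an expression with $n=\ell(w)$ is reduced. A root system of type $\mathcal{C}$ is a family of sets $\Delta^X\subset\mathbb{Z}^I$ such that: $\Delta^X=(\Delta^X\cap\mathbb{N}_0^I)\cup-(\Delta^X\cap\mathbb{N}_0^I)$; $\Delta^X\cap\mathbb{Z}\alpha_i=\{\pm\alpha_i\}$; $s_i^X(\Delta^X)=\Delta^{r_i(X)}$; and, with $m^X_{ij}=|\Delta^X\cap(\mathbb{N}_0\alpha_i+\mathbb{N}_0\alpha_j)|$, $(r_ir_j)^{m^X_{ij}}(X)=X$ for $i\neq j$. Put $\Delta^X_+=\Delta^X\cap\mathbb{N}_0^I$. It is finite if some (equivalently every) $\Delta^X$ is finite. A total order $<$ on $\Delta^X_+$ is convex if for all $\alpha<\beta$ in $\Delta^X_+$ with $\alpha+\beta\in\Delta^X_+$ one has $\alpha<\alpha+\beta<\beta$. It is strongly convex if for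 every $k\ge2$ and $\alpha_1\le\dots\le\alpha_k$ in $\Delta^X_+$ with $\alpha:=\sum_i\alpha_i\in\Delta^X_+$ one has $\alpha_1<\alpha<\alpha_k$. *)

(* Defs.v *)
From HB Require Import structures.
From mathcomp Require Import all_boot all_order all_algebra.
From mathcomp Require Import boolp classical_sets functions cardinality.

Set Implicit Arguments.
Unset Strict Implicit.
Unset Printing Implicit Defensive.

Import Order.TTheory GRing.Theory Num.Theory.

Local Open Scope classical_set_scope.
Local Open Scope card_scope.
Local Open Scope ring_scope.

Notation Zlat I := {ffun I -> int}.

Section Lattice.
Variable I : finType.

Definition alpha (i : I) : Zlat I := [ffun j => (j == i)%:Z].

Definition nonneg : set (Zlat I) := [set v | forall i, 0 <= v i].

Definition gen_cartan_matrix (a : I -> I -> int) : Prop :=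
  [/\ forall i, a i i = 2,
      forall i j, i != j -> a i j <= 0
    & forall i j, a i j = 0 -> a j i = 0].

End Lattice.

Record cartan_scheme (I : finType) (obj : Type) := CartanScheme {
  robj : I -> obj -> obj;
  cmat : obj -> I -> I -> int;
  idx_nonempty : (0 < #|I|)%N;
  obj_nonempty : inhabited obj;
  robj_invol : forall i X, robj i (robj i X) = X;
  cmat_gcm : forall X, gen_cartan_matrix (cmat X);
  cmat_robj : forall i j X, cmat X i j = cmat (robj i X) i j
}.

Section WeylGroupoid.
Variables (I : finType) (obj : Type) (C : cartan_scheme I obj).
Implicit Types (X Y Z : obj) (f g : Zlat I -> Zlat I).

(* The Z-linear extension of alpha j |-> alpha j - a^X_ij alpha i;
   see srefl_alpha below. *)
Definition srefl X (i : I) : Zlat I -> Zlat I :=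
  fun v => \sum_j (alpha j - alpha i *~ cmat C X i j) *~ v j.

(* hom X Y f : the linear map f underlies a morphism in Hom(X, Y); inverses
   come for free since s_i^(r_i X) is inverse to s_i^X. *)
Inductive hom : obj -> obj -> (Zlat I -> Zlat I) -> Prop :=
| hom_id X : hom X X idfun
| hom_s X i : hom X (robj C i X) (srefl X i)
| hom_comp X Y Z f g : hom X Y f -> hom Y Z g -> hom X Z (g \o f).

Definition connected_groupoid : Prop := forall X Y, exists f, hom Y X f.

(* A morphism with target X is a pair (source, linear map); two such are
   equal when both the sources and the maps agree. *)
Definition homW X : set (obj * (Zlat I -> Zlat I)) :=
  [set w | hom w.1 X w.2].

(* id_X s_{i_1} ... s_{i_m}, paired with its source. *)
Fixpoint word X (t : seq I) : obj * (Zlat I -> Zlat I) :=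
  if t is i :: t' then
    let w := word (robj C i X) t' in (w.1, srefl (robj C i X) i \o w.2)
  else (X, idfun).

Definition has_length X (w : obj * (Zlat I -> Zlat I)) (n : nat) : Prop :=
  (exists t : seq I, size t = n /\ word X t = w) /\
  (forall t : seq I, word X t = w -> (n <= size t)%N).

Definition reduced X (t : seq I) : Prop := has_length X (word X t) (size t).

Definition max_length X (w : obj * (Zlat I -> Zlat I)) : Prop :=
  homW X w /\
  exists2 n, has_length X w n &
    forall w' n', homW X w' -> has_length X w' n' -> (n' <= n)%N.

(* Indices start at 0: beta t j is s_{i_1} ... s_{i_j} (alpha_{i_(j+1)}). *)
Definition beta X (m : nat) (t : m.-tuple I) (j : 'I_m) : Zlat I :=
  (word X (take j t)).2 (alpha (tnth t j)).

Definition pos_roots (Delta : obj -> set (Zlat I)) X : set (Zlat I) :=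
  Delta X `&` @nonneg I.

(* In the last clause m is the cardinality m^X_ij; when that cardinality is
   infinite there is no such m, hence no condition. *)
Record root_system (Delta : obj -> set (Zlat I)) : Prop := RootSystem {
  rs_sign : forall X,
    Delta X = pos_roots Delta X `|` [set - v | v in pos_roots Delta X];
  rs_simple : forall X i,
    Delta X `&` [set alpha i *~ z | z in [set: int]] = [set alpha i; - alpha i];
  rs_refl : forall X i, srefl X i @` Delta X = Delta (robj C i X);
  rs_braid : forall X i j (m : nat), i != j ->
    Delta X `&` [set v | exists p q : nat, v = alpha i *+ p + alpha j *+ q]
      #= `I_m ->
    iter m (robj C i \o robj C j) X = X
}.

Definition finite_root_system (Delta : obj -> set (Zlat I)) : Prop :=
  root_system Delta /\ exists X, finite_set (Delta X).

End WeylGroupoid.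

Definition total_order_on (I : finType) (A : set (Zlat I))
    (le : rel (Zlat I)) : Prop :=
  [/\ {in A, reflexive le}, {in A &, antisymmetric le},
      {in A & &, transitive le} & {in A &, total le}].

Definition slt (I : finType) (le : rel (Zlat I)) : rel (Zlat I) :=
  fun x y => (x != y) && le x y.

Definition from_reduced_longest (I : finType) (obj : Type)
    (C : cartan_scheme I obj) (Delta : obj -> set (Zlat I)) (X : obj)
    (le : rel (Zlat I)) : Prop :=
  exists (m : nat) (t : m.-tuple I),
    [/\ reduced C X t, max_length C X (word C X t),
        pos_roots Delta X = range (beta C X t)
      & forall j k : 'I_m, (j < k)%N -> slt le (beta C X t j) (beta C X t k)].

Definition convex_order (I : finType) (A : set (Zlat I))
    (le : rel (Zlat I)) : Prop :=
  forall x y, A x -> A y -> slt le x y -> A (x + y) ->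
    slt le x (x + y) /\ slt le (x + y) y.

Definition strongly_convex_order (I : finType) (A : set (Zlat I))
    (le : rel (Zlat I)) : Prop :=
  forall t : seq (Zlat I), (2 <= size t)%N ->
    (forall x, x \in t -> A x) -> sorted le t -> A (\sum_(x <- t) x) ->
    slt le (head 0 t) (\sum_(x <- t) x) /\ slt le (\sum_(x <- t) x) (last 0 t).

Lemma srefl_alpha (I : finType) (obj : Type) (C : cartan_scheme I obj)
    (X : obj) (i j : I) :
  srefl C X i (alpha j) = alpha j - alpha i *~ cmat C X i j.
Proof.
rewrite /srefl (bigD1 j) //= big1 ?addr0 => [|k /negPf kj]; rewrite ffunE.
  by rewrite eqxx.
by rewrite kj.
Qed.

(* Main.v *)
(* The word w = s_{i_1} ... s_{i_m} with all beta_j positive has exactly the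
   beta_j as inversions, and the prefix of length j makes beta_1, ..., beta_j
   negative and the other positive roots positive.  Hence for a sum of positive
   roots lying in positions p to q, applying the inverses of the prefixes of
   length p - 1 and q shows that the sum lies in positions p to q as well: this
   is strong convexity.

   Conversely, given a convex order, build the word letter by letter so that the
   beta_j exhaust the order from below.  If w is the current prefix and delta
   the least remaining root, then w^{-1} delta is positive, and if it were not
   simple it would be a sum x + y of two positive roots.  In delta = w x + w y,
   either both summands are remaining roots and convexity puts one of them
   below delta, or one of them is the opposite of a root gamma already listed
   and the other, gamma + delta, lies strictly below delta by convexity.

   This uses two facts on finite root systems: length equals the number of
   inversions (the exchange argument through rank two, where the Coxeter
   relations are needed), so that the word obtained is reduced and longest; and
   every positive root that is not simple is a sum of two positive roots, by
   reduction to rank two. *)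
Require Import Defs.
From HB Require Import structures.
From mathcomp Require Import all_boot all_order all_algebra finmap.
From mathcomp Require Import boolp classical_sets functions cardinality.
From mathcomp Require Import zify.

Set Implicit Arguments.
Unset Strict Implicit.
Unset Printing Implicit Defensive.

Import Order.TTheory GRing.Theory Num.Theory.

Local Open Scope ring_scope.

(** * Coordinates in the root lattice *)

Section Lattice.
Variable I : finType.
Implicit Types (v w : Zlat I) (i j k : I).

(* Restating the generic [ffunE] at type [int] keeps the coordinates in a
   form that [lia] recognizes. *)
Lemma ZlatD v w k : (v + w) k = v k + w k.
Proof. by rewrite ffunE. Qed.

Lemma ZlatN v k : (- v) k = - v k.
Proof. by rewrite ffunE. Qed.

Lemma Zlat0 k : (0 : Zlat I) k = 0.
Proof. by rewrite ffunE. Qed.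

Lemma ZlatMz v (z : int) k : (v *~ z) k = v k * z.
Proof.
have N n : (v *+ n) k = v k * n%:Z.
  elim: n => [|n IH]; first by rewrite mulr0n mulr0 Zlat0.
  by rewrite mulrS ZlatD IH intS mulrDr mulr1.
by case: z => n; rewrite ?NegzE ?mulrNz ?ZlatN -?pmulrn N ?mulrN.
Qed.

Lemma alphaE i k : alpha i k = (k == i)%:Z.
Proof. by rewrite ffunE. Qed.

Definition ZlatE := (ZlatD, ZlatN, Zlat0, ZlatMz, alphaE).

Lemma Zlat_expand v : v = \sum_i alpha i *~ v i.
Proof.
apply/ffunP => k; rewrite sum_ffunE (bigD1 k) //= big1 => [|i ik].
  by rewrite ZlatMz ZlatE eqxx mul1r addr0.
by rewrite ZlatMz ZlatE eq_sym (negPf ik) mul0r.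
Qed.

End Lattice.

(** * Words in the Weyl groupoid *)

Section Words.
Variables (I : finType) (obj : Type) (C : cartan_scheme I obj).
Implicit Types (X Y : obj) (v : Zlat I) (i j k : I) (t u : seq I).

Local Notation r := (robj C).
Local Notation s := (srefl C).

Lemma sreflE X i v :
  s X i v = v - alpha i *~ (\sum_j cmat C X i j * v j).
Proof.
rewrite /srefl [in RHS]mulrz_sumr {2}[v]Zlat_expand -sumrB.
by apply: eq_bigr => j _; rewrite mulrzBl -mulrzA.
Qed.

Lemma srefl_coord X i v k : k != i -> s X i v k = v k.
Proof.
by move=> ki; rewrite sreflE !ZlatE (negPf ki) mul0r subr0.
Qed.

Lemma srefl_is_zmod_morphism X i : GRing.zmod_morphism (s X i).
Proof.
move=> v w; rewrite /srefl -sumrB; apply: eq_bigr => j _.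
by rewrite !ZlatE mulrzBr.
Qed.

HB.instance Definition _ X i :=
  GRing.isZmodMorphism.Build (Zlat I) (Zlat I) (s X i)
    (srefl_is_zmod_morphism X i).

Lemma srefl_alpha_id X i : s X i (alpha i) = - alpha i.
Proof.
have [a2 _ _] := cmat_gcm C X.
by rewrite srefl_alpha a2 -[2]/(1 + 1) mulrzDr mulr1z opprD addrA subrr sub0r.
Qed.

Lemma srefl_robj X i : s (r i X) i = s X i.
Proof. by apply/funext => v; rewrite /srefl; under eq_bigr do rewrite -cmat_robj. Qed.

Lemma sreflK X i : involutive (s X i).
Proof.
move=> v; rewrite [X in s _ _ X]sreflE raddfB raddfMz /= srefl_alpha_id.
by rewrite sreflE mulNrz opprK subrK.
Qed.

Definition ends X t : obj := foldl (fun Y i => r i Y) X t.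

(** The linear map of the word. Each letter uses the reflection at the near object, the same map as
    in [word] by [srefl_robj]; [coact] below is its inverse, from roots at [X] to roots at
    [ends X t]. *)
Fixpoint act X t v : Zlat I :=
  if t is i :: t' then s X i (act (r i X) t' v) else v.

Fixpoint coact X t v : Zlat I :=
  if t is i :: t' then coact (r i X) t' (s X i v) else v.

Lemma wordE X t : word C X t = (ends X t, act X t).
Proof.
elim: t X => [|i t IH] X; first by [].
by rewrite /= IH srefl_robj.
Qed.

Lemma act_is_zmod_morphism X t : GRing.zmod_morphism (act X t).
Proof.
elim: t X => [|i t IH] X v w; first by [].
by rewrite /= IH raddfB.
Qed.

HB.instance Definition _ X t :=
  GRing.isZmodMorphism.Build (Zlat I) (Zlat I) (act X t)
    (act_is_zmod_morphism X t).

Lemma coact_is_zmod_morphism X t : GRing.zmod_morphism (coact X t).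
Proof.
elim: t X => [|i t IH] X v w; first by [].
by rewrite /= raddfB IH.
Qed.

HB.instance Definition _ X t :=
  GRing.isZmodMorphism.Build (Zlat I) (Zlat I) (coact X t)
    (coact_is_zmod_morphism X t).

Lemma actK X t : cancel (act X t) (coact X t).
Proof. by elim: t X => [|i t IH] X v //=; rewrite sreflK IH. Qed.

Lemma coactK X t : cancel (coact X t) (act X t).
Proof. by elim: t X => [|i t IH] X v //=; rewrite IH sreflK. Qed.

Lemma ends_cat X t u : ends X (t ++ u) = ends (ends X t) u.
Proof. exact: foldl_cat. Qed.

Lemma act_cat X t u v : act X (t ++ u) v = act X t (act (ends X t) u v).
Proof. by elim: t X => //= i t IH X; rewrite IH. Qed.

Lemma coact_cat X t u v :
  coact X (t ++ u) v = coact (ends X t) u (coact X t v).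
Proof. by elim: t X v => //= i t IH X v; rewrite IH. Qed.

Lemma ends_rcons X t i : ends X (rcons t i) = r i (ends X t).
Proof. by rewrite -cats1 ends_cat. Qed.

Lemma act_rcons X t i v : act X (rcons t i) v = act X t (s (ends X t) i v).
Proof. by rewrite -cats1 act_cat. Qed.

Lemma coact_rcons X t i v :
  coact X (rcons t i) v = s (ends X t) i (coact X t v).
Proof. by rewrite -cats1 coact_cat. Qed.

Lemma word_catl u X t t' :
  word C X t = word C X t' -> word C X (t ++ u) = word C X (t' ++ u).
Proof.
rewrite !wordE !ends_cat => -[e a]; rewrite e; congr pair.
by apply/funext => v; rewrite !act_cat e a.
Qed.

Lemma word_catr X t u u' : word C (ends X t) u = word C (ends X t) u' ->
  word C X (t ++ u) = word C X (t ++ u').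
Proof.
rewrite !wordE !ends_cat => -[e a]; rewrite e; congr pair.
by apply/funext => v; rewrite !act_cat a.
Qed.

Lemma word_dup X t i : word C X (rcons (rcons t i) i) = word C X t.
Proof.
rewrite !wordE !ends_rcons robj_invol; congr pair.
by apply/funext => v; rewrite !act_rcons ends_rcons srefl_robj sreflK.
Qed.

Lemma word_coact X t t' :
  word C X t = word C X t' -> coact X t =1 coact X t'.
Proof. by rewrite !wordE => -[_ a] v; rewrite -{1}[v](coactK X t') -a actK. Qed.

Lemma hom_word X Y f : Defs.hom C X Y f -> exists t, word C Y t = (X, f).
Proof.
elim=> [Z|Z i|Z1 Z2 Z3 g1 g2 _ [t1 e1] _ [t2 e2]].
- by exists [::].
- exists [:: i]; rewrite wordE /= robj_invol; congr pair.
  by apply/funext => v; rewrite /= srefl_robj.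
- exists (t2 ++ t1); move: e1 e2; rewrite !wordE ends_cat => -[e1 a1] [e2 a2].
  rewrite e2 e1 -a1 -a2; congr pair; apply/funext => v /=.
  by rewrite act_cat e2.
Qed.

Lemma word_hom X t : Defs.hom C (word C X t).1 X (word C X t).2.
Proof.
elim: t X => [|i t IH] X; first exact: hom_id.
apply: hom_comp (IH (r i X)) _.
by have := hom_s C (r i X) i; rewrite robj_invol.
Qed.

(** The roots beta_1, ..., beta_m of the word, by recursion on its first letter; [betas_rcons]
    serves the inductions on the last one. *)
Fixpoint betas X t : seq (Zlat I) :=
  if t is i :: t' then alpha i :: map (s X i) (betas (r i X) t') else [::].

Lemma size_betas X t : size (betas X t) = size t.
Proof. by elim: t X => //= i t IH X; rewrite size_map IH. Qed.

Lemma betas_rcons X t i :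
  betas X (rcons t i) = rcons (betas X t) (act X t (alpha i)).
Proof. by elim: t X => //= j t IH X; rewrite IH map_rcons. Qed.

Lemma betas_cat X t u :
  betas X (t ++ u) = betas X t ++ map (act X t) (betas (ends X t) u).
Proof.
elim: t X => [|j t IH] X /=; first by rewrite map_id_in.
by rewrite IH map_cat -map_comp.
Qed.

Lemma nth_betas X t (k : nat) i0 : (k < size t)%N ->
  nth 0 (betas X t) k = act X (take k t) (alpha (nth i0 t k)).
Proof.
elim: t X k => [|i t IH] X [|k] //= kt.
by rewrite (nth_map 0) ?size_betas// IH.
Qed.

Lemma betas_take X t (k : nat) : betas X (take k t) = take k (betas X t).
Proof.
elim: t X k => [|i t IH] X [|k] //=.
by rewrite IH map_take.
Qed.

End Words.

(** * Roots, inversions and the rank two subsystems *)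

Section RootSystem.
Variables (I : finType) (obj : Type) (C : cartan_scheme I obj).
Variables (Delta : obj -> set (Zlat I)) (RS : root_system C Delta).
Implicit Types (X Y : obj) (v w : Zlat I) (i j k : I) (t u : seq I).

Local Notation r := (robj C).
Local Notation s := (srefl C).
Local Notation pos := (pos_roots Delta).
Local Notation act := (act C).
Local Notation coact := (coact C).
Local Notation ends := (ends C).
Local Notation betas := (betas C).

Definition height v : int := \sum_i v i.

Lemma height_is_zmod_morphism : GRing.zmod_morphism height.
Proof.
by move=> v w; rewrite /height -sumrB; apply: eq_bigr => i _; rewrite !ZlatE.
Qed.

HB.instance Definition _ :=
  GRing.isZmodMorphism.Build (Zlat I) int height height_is_zmod_morphism.

Lemma height_alpha i : height (alpha i) = 1.
Proof.
rewrite /height (bigD1 i) //= big1 ?ZlatE ?eqxx ?addr0 // => j ji.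
by rewrite ZlatE (negPf ji).
Qed.

Lemma root_pm X v : Delta X v -> pos X v \/ pos X (- v).
Proof.
rewrite {1}(rs_sign RS) => -[|[w pw <-]]; first by left.
by right; rewrite opprK.
Qed.

Lemma root_opp X v : Delta X v -> Delta X (- v).
Proof.
rewrite {1}(rs_sign RS) => -[pv|[w pw <-]]; last by rewrite opprK; case: pw.
by rewrite (rs_sign RS); right; exists v.
Qed.

Lemma root_multiple_alpha X i (z : int) :
  Delta X (alpha i *~ z) -> alpha i *~ z = alpha i \/ alpha i *~ z = - alpha i.
Proof.
move=> Dz; have : (Delta X `&` [set alpha i *~ z | z in [set: int]])%classic
  (alpha i *~ z) by split => //; exists z.
by rewrite (rs_simple RS).
Qed.

Lemma alpha_neq0 i : alpha i != 0.
Proof. by apply/eqP => /ffunP/(_ i); rewrite !ZlatE eqxx. Qed.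

Lemma nonneg_alpha i : nonneg (alpha i).
Proof. by move=> j; rewrite ZlatE. Qed.

Lemma alpha_pos X i : pos X (alpha i).
Proof.
split; last exact: nonneg_alpha.
have : ([set alpha i; - alpha i])%classic (alpha i) by left.
by rewrite -(rs_simple RS X) => -[].
Qed.

Lemma root_neq0 X v : Delta X v -> v != 0.
Proof.
move=> Dv; apply/eqP => v0; case: (idx_nonempty C) => /card_gt0P[i _].
move: Dv; rewrite v0 -[0](mulr0z (alpha i)) => /root_multiple_alpha.
rewrite mulr0z => -[/esym/eqP|/esym/eqP]; rewrite ?oppr_eq0;
  by rewrite (negPf (alpha_neq0 i)).
Qed.

Lemma nonneg_opp_eq0 v : nonneg v -> nonneg (- v) -> v = 0.
Proof.
move=> nv nNv; apply/ffunP => k; have := nv k; have := nNv k.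
by rewrite !ZlatE; lia.
Qed.

Lemma pos_opp X v : pos X v -> ~ nonneg (- v).
Proof.
by move=> [Dv nv] nNv; have := root_neq0 Dv; rewrite (nonneg_opp_eq0 nv nNv) eqxx.
Qed.

Lemma nonneg_height v : nonneg v -> 0 <= height v.
Proof. by move=> nv; exact: sumr_ge0. Qed.

Lemma pos_height X v : pos X v -> 0 < height v.
Proof.
move=> [Dv nv]; rewrite lt_def nonneg_height // andbT psumr_neq0 //.
apply/hasP; case: (boolP [exists k, v k != 0]) => [/existsP[k vk]|].
  by exists k; rewrite ?mem_index_enum // lt_def vk nv.
rewrite negb_exists => /forallP v0; have /eqP[] := root_neq0 Dv.
by apply/ffunP => k; rewrite ZlatE; apply/eqP; rewrite -[_ == _]negbK v0.
Qed.

Lemma nonneg_height1 v : nonneg v -> height v = 1 -> exists i, v = alpha i.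
Proof.
move=> nv hv; have : height v != 0 by rewrite hv.
rewrite /height psumr_neq0 // => /hasP[i _ /= vi]; exists i.
move: hv; rewrite /height (bigD1 i) //=; set z := (X in _ + X) => hv.
have z0 : 0 <= z by exact: sumr_ge0.
have v0 : z = 0 by lia.
apply/ffunP => k; rewrite ZlatE; case: eqVneq => [->|ki]; first by lia.
by apply: (psumr_eq0P _ v0).
Qed.

Lemma root_srefl X i v : Delta X v -> Delta (r i X) (s X i v).
Proof. by move=> Dv; rewrite -(rs_refl RS); exists v. Qed.

(** Coordinates away from [i] do not change. If the image is negative they all vanish, so the root
    is a multiple of [alpha i], hence [alpha i] itself. *)
Lemma pos_srefl X i v : pos X v -> v <> alpha i -> pos (r i X) (s X i v).
Proof.
move=> [Dv nv] vi; have Dsv := root_srefl i Dv.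
have [//|[_ nNsv]] := root_pm Dsv; case: vi.
have ev : v = alpha i *~ v i.
  apply/ffunP => k; rewrite ZlatMz ZlatE; case: eqVneq => [->|ki].
    by rewrite mul1r.
  have := nNsv k; have := nv k; rewrite ZlatE srefl_coord // mul0r; lia.
move: Dv; rewrite ev => /root_multiple_alpha[//|]; rewrite -ev => vN.
by have := nv i; rewrite vN !ZlatE eqxx.
Qed.

Lemma root_act X t v : Delta (ends X t) v -> Delta X (act X t v).
Proof.
elim: t X => [//|i t IH] X /= /IH /(root_srefl i).
by rewrite robj_invol srefl_robj.
Qed.

Lemma root_act_alpha X t i : Delta X (act X t (alpha i)).
Proof. by apply: root_act; case: (alpha_pos (ends X t) i). Qed.

Lemma root_coact X t v : Delta X v -> Delta (ends X t) (coact X t v).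
Proof. by elim: t X v => [//|i t IH] X v /= /(root_srefl i)/IH. Qed.

(** Follow the root along the letters: by [pos_srefl], at the first letter that makes it negative it
    is the simple root of that letter. *)
Lemma sign_change X t v : pos X v -> pos (ends X t) (- coact X t v) ->
  v \in betas X t \/ - v \in betas X t.
Proof.
elim: t X v => [|i t IH] X v pv /=; first by move=> [_ /(pos_opp pv)].
case: (eqVneq v (alpha i)) => [-> _|/eqP vi]; first by left; rewrite mem_head.
move=> /(IH _ _ (pos_srefl pv vi)).
by case=> /(map_f (s X i)); rewrite ?raddfN /= sreflK;
  [left|right]; rewrite inE; apply/orP; right.
Qed.

(** Stands in for reducedness, in a form suited to induction on the last letter; [good_shortest] and
    [shortest_good] show that the two agree. *)
Definition good X t := forall v, v \in betas X t -> pos X v.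

Lemma good_rcons X t i :
  good X (rcons t i) <-> good X t /\ pos X (act X t (alpha i)).
Proof.
rewrite /good betas_rcons; split=> [g|[g pi] v].
  by split=> [v vt|]; apply: g; rewrite mem_rcons inE ?eqxx ?vt ?orbT.
by rewrite mem_rcons inE => /predU1P[->|/g].
Qed.

Lemma good_catl X t u : good X (t ++ u) -> good X t.
Proof. by move=> g v vt; apply: g; rewrite betas_cat mem_cat vt. Qed.

(** The last letter makes its own root negative. An earlier root stays negative: otherwise its
    opposite would have been [alpha i] just before, and the last root would be the opposite of a
    positive one. *)
Lemma good_neg X t v :
  good X t -> v \in betas X t -> pos (ends X t) (- coact X t v).
Proof.
elim/last_ind: t => [//|t i IH] /good_rcons[g pi].
rewrite betas_rcons mem_rcons inE coact_rcons ends_rcons => /predU1P[->|vt].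
  by rewrite actK srefl_alpha_id opprK; exact: alpha_pos.
rewrite -raddfN /=; apply: pos_srefl (IH g vt) _ => e.
have [_ nv] := g _ vt; apply: (pos_opp pi).
by rewrite -e raddfN /= coactK opprK.
Qed.

Lemma good_betas_neg X t v : good X t -> pos X v ->
  pos (ends X t) (- coact X t v) -> v \in betas X t.
Proof.
move=> g pv /(sign_change pv)[//|/g[_ /(pos_opp pv)]]; exact.
Qed.

Lemma good_coact_pos X t v : good X t -> pos X v -> v \notin betas X t ->
  pos (ends X t) (coact X t v).
Proof.
move=> g pv vt; have [//|/(good_betas_neg g pv)] :=
  root_pm (root_coact t (proj1 pv)).
by rewrite (negPf vt).
Qed.

Lemma good_uniq X t : good X t -> uniq (betas X t).
Proof.
elim/last_ind: t => [//|t i IH] /good_rcons[g pi].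
rewrite betas_rcons rcons_uniq IH // andbT; apply/negP => /(good_neg g).
by rewrite actK => -[_] /(pos_opp (alpha_pos (ends X t) i)).
Qed.

Definition shortest X t :=
  forall t', word C X t' = word C X t -> (size t <= size t')%N.

(** Which positive roots become negative depends only on the element, so every root of [t] occurs,
    up to the sign removed by [nrm], among those of any other word for it. *)
Lemma good_shortest X t : good X t -> shortest X t.
Proof.
move=> g t' e; pose nrm v := if `[< nonneg v >] then v else - v.
rewrite -(size_betas C X t) -(size_betas C X t') -[leqRHS](size_map nrm).
apply: uniq_leq_size (good_uniq g) _ => v vt.
have := good_neg g vt; rewrite -(word_coact e).
have -> : ends X t = ends X t' by move: e; rewrite !wordE => -[].
move=> /(sign_change (g _ vt)) [] /(map_f nrm); rewrite /nrm.
  by rewrite asboolT //; case: (g _ vt).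
by rewrite asboolF ?opprK //; exact: pos_opp (g _ vt).
Qed.

Lemma shortest_catl X t u : shortest X (t ++ u) -> shortest X t.
Proof.
move=> st t' e; have := st _ (word_catl u e).
by rewrite !size_cat leq_add2r.
Qed.

Lemma shortest_catr X t u : shortest X (t ++ u) -> shortest (ends X t) u.
Proof.
move=> st u' e; have := st _ (word_catr e); by rewrite !size_cat leq_add2l.
Qed.

Lemma shortest_eq X t u : size t = size u ->
  word C X t = word C X u -> shortest X t -> shortest X u.
Proof. by move=> e ew st t' et'; rewrite -e; apply: st; rewrite et'. Qed.

(** * Rank two subsystems and words over two letters *)

Definition rk2 i j v := forall k, k != i -> k != j -> v k = 0.

Definition over i j t := all (pred2 i j) t.

Lemma act_coord X i j t v k : over i j t -> k != i -> k != j ->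
  act X t v k = v k.
Proof.
move=> ot ki kj; elim: t X ot => [//|c t IH] X /= /andP[/orP c12 /IH e].
rewrite srefl_coord ?e //.
by case: c12 => /eqP->.
Qed.

Lemma coact_coord X i j t v k : over i j t -> k != i -> k != j ->
  coact X t v k = v k.
Proof. by move=> ot ki kj; rewrite -{2}[v](coactK C X t) (act_coord _ _ ot). Qed.

Lemma rk2_alphal i j : rk2 i j (alpha i).
Proof. by move=> k ki kj; rewrite ZlatE (negPf ki). Qed.

Lemma rk2_alphar i j : rk2 i j (alpha j).
Proof. by move=> k ki kj; rewrite ZlatE (negPf kj). Qed.

Lemma rk2_sym i j v : rk2 i j v -> rk2 j i v.
Proof. by move=> rv k ki kj; apply: rv. Qed.

Lemma rk2_act X i j t v : over i j t -> rk2 i j v -> rk2 i j (act X t v).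
Proof. by move=> ot rv k ki kj; rewrite (act_coord _ _ ot) // rv. Qed.

Lemma rk2_coact X i j t v : over i j t -> rk2 i j v -> rk2 i j (coact X t v).
Proof. by move=> ot rv k ki kj; rewrite (coact_coord _ _ ot) // rv. Qed.

Lemma rk2_betas X i j t v : over i j t -> v \in betas X t -> rk2 i j v.
Proof.
elim/last_ind: t => [//|t c IH]; rewrite /over all_rcons => /andP[c12 ot].
rewrite betas_rcons mem_rcons inE => /predU1P[->|]; last exact: IH.
by apply: rk2_act ot _; case/orP: c12 => /eqP->;
  [exact: rk2_alphal|exact: rk2_alphar].
Qed.

Lemma rk2_expand i j v : i != j -> rk2 i j v ->
  v = alpha i *~ v i + alpha j *~ v j.
Proof.
move=> ij rv; apply/ffunP => k; rewrite !ZlatE.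
case: (eqVneq k i) => [->|ki]; first by rewrite (negPf ij); lia.
by case: (eqVneq k j) => [->|kj]; last rewrite rv; lia.
Qed.

Lemma nonneg_mulz v (z : int) : nonneg v -> 0 <= z -> nonneg (v *~ z).
Proof. by move=> nv z0 k; rewrite ZlatMz mulr_ge0. Qed.

Lemma nonneg_add v w : nonneg v -> nonneg w -> nonneg (v + w).
Proof. by move=> nv nw k; rewrite ZlatE addr_ge0. Qed.

Lemma root_pos_coord X v k : Delta X v -> 0 < v k -> pos X v.
Proof.
move=> /root_pm[//|[_ nv]] vk; have := nv k.
by rewrite ZlatE oppr_ge0 leNgt vk.
Qed.

Lemma pos_act_rk2 X u i j v : i != j ->
  nonneg (act X u (alpha i)) -> nonneg (act X u (alpha j)) ->
  pos (ends X u) v -> rk2 i j v -> pos X (act X u v).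
Proof.
move=> ij pi pj [Dv nv] rv; split; first exact: root_act.
rewrite (rk2_expand ij rv) raddfD !raddfMz /=.
by apply: nonneg_add; exact: nonneg_mulz.
Qed.

Lemma act_rk2 X u i j v : i != j -> rk2 i j v ->
  act X u v = act X u (alpha i) *~ v i + act X u (alpha j) *~ v j.
Proof.
by move=> ij rv; rewrite {1}(rk2_expand ij rv) raddfD !raddfMz.
Qed.

Lemma good_last X t i :
  good X (rcons t i) -> pos X (- act X (rcons t i) (alpha i)).
Proof.
by case/good_rcons=> _; rewrite act_rcons srefl_alpha_id raddfN opprK.
Qed.

(** * Alternating words and the longest word of rank two *)

Definition letter i j (n : nat) := if odd n then j else i.

Definition alt i j (n : nat) : seq I := mkseq (letter i j) n.

Lemma letterS i j n : letter i j n.+1 = letter j i n.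
Proof. by rewrite /letter /=; case: odd. Qed.

Lemma altS i j n : alt i j n.+1 = rcons (alt i j n) (letter i j n).
Proof. exact: mkseqS. Qed.

Lemma size_alt i j n : size (alt i j n) = n.
Proof. exact: size_mkseq. Qed.

Lemma overC i j t : over i j t = over j i t.
Proof. by apply: eq_all => k /=; rewrite orbC. Qed.

Lemma over_alt i j n : over i j (alt i j n).
Proof.
elim: n => [//|n IH]; rewrite altS /over all_rcons; apply/andP; split => //.
by rewrite /letter /=; case: odd; rewrite eqxx ?orbT.
Qed.

Lemma over_rcons i j t k :
  over i j (rcons t k) = ((k == i) || (k == j)) && over i j t.
Proof. by rewrite /over all_rcons. Qed.

Lemma good_over_alt X i j t : i != j -> over i j t -> good X t ->
  t = alt i j (size t) \/ t = alt j i (size t).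
Proof.
move=> ij; elim/last_ind: t => [|t k IH]; first by left.
rewrite over_rcons size_rcons !altS => /andP[kij /IH {}IH] g.
have [gt pk] := (good_rcons _ _ _).1 g; have {}IH := IH gt.
case: (posnP (size t)) => [t0|t_gt0].
  rewrite t0 (size0nil t0).
  by case/orP: kij => /eqP->; [left|right].
suff h p q : t = alt p q (size t) -> (k == p) || (k == q) ->
    k = letter p q (size t).
  case: IH => e; [left|right]; rewrite -e; congr rcons; first exact: h.
  by apply: h => //; rewrite orbC.
case: (size t) t_gt0 => // n _; rewrite altS => e kpq.
have kn : k != letter p q n.
  apply/eqP => kl; rewrite kl e in pk; rewrite e in gt.
  by have [_ np] := good_last gt; have := pos_opp pk np.
by move: kn kpq; rewrite /letter /=; case: odd => /= /negPf->; rewrite ?orbF => /eqP.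
Qed.

(** If the inverse image of [v] were positive, [v] would be a nonnegative combination of the two
    nonpositive images. *)
Lemma rk2_longest_betas X i j t v : i != j -> over i j t -> good X t ->
  nonneg (- act X t (alpha i)) -> nonneg (- act X t (alpha j)) ->
  pos X v -> rk2 i j v -> v \in betas X t.
Proof.
move=> ij ot g ni nj pv rv; apply: (good_betas_neg g pv).
have [[Dx nx]|//] := root_pm (root_coact t (proj1 pv)).
exfalso; apply: (pos_opp pv).
rewrite -[v](coactK C X t) (act_rk2 _ _ ij (rk2_coact _ ot rv)).
by rewrite opprD -!mulNrz; apply: nonneg_add; exact: nonneg_mulz.
Qed.

(** The length of such a list is the exponent m_ij of the Coxeter relation, by [enum_rk2_card]. *)
Definition enum_rk2 X i j (l : seq (Zlat I)) :=
  uniq l /\ forall v, v \in l <-> pos X v /\ rk2 i j v.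

Lemma enum_rk2C X i j l : enum_rk2 X i j l -> enum_rk2 X j i l.
Proof.
move=> [ul el]; split => // v; rewrite el.
by split=> -[pv rv]; split => //; exact: rk2_sym.
Qed.

Lemma enum_rk2_ge2 X i j l : i != j -> enum_rk2 X i j l -> (1 < size l)%N.
Proof.
move=> ij [ul el]; apply: (@uniq_leq_size _ [:: alpha i; alpha j]).
  rewrite /= inE andbT; apply: contraNneq ij => /ffunP/(_ i).
  by rewrite !ZlatE eqxx; case: eqVneq.
move=> v; rewrite !inE => /orP[] /eqP->; apply/el; split.
- exact: alpha_pos.
- exact: rk2_alphal.
- exact: alpha_pos.
- exact: rk2_alphar.
Qed.

Lemma letter_over i j n (P : I -> Prop) :
  P (letter i j n) -> P (letter j i n) -> P i /\ P j.
Proof. by rewrite /letter; case: odd. Qed.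

(** If the next root were negative, the word would make both simple roots negative and so contain
    all positive roots of the subsystem among its own; there are more of those than letters. *)
Lemma alt_good X i j l n : i != j -> enum_rk2 X i j l ->
  (n <= size l)%N -> good X (alt i j n).
Proof.
move=> ij [ul el]; elim: n => [_ v //|n IH nl].
have {IH} g := IH (ltnW nl); rewrite altS; apply/good_rcons; split => //.
have [//|[_ nn]] := root_pm (root_act_alpha X (alt i j n) (letter i j n)).
case: n => [|n] in g nl nn *; first exact: alpha_pos.
have [_ nn'] := @good_last X (alt i j n) (letter i j n) ltac:(by rewrite -altS).
rewrite -altS in nn'; rewrite letterS in nn.
have [ni nj] := letter_over (P := fun k => nonneg (- act X _ (alpha k))) nn' nn.
have sub : {subset l <= betas X (alt i j n.+1)}.
  move=> v /el[pv rv].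
  exact: (rk2_longest_betas ij (over_alt i j _) g ni nj pv rv).
have := uniq_leq_size ul sub.
by rewrite size_betas size_alt leqNgt nl.
Qed.

(** For the last letter this is [good_last]. If the other simple root stayed positive, one more
    letter would give more distinct positive roots than the subsystem has. *)
Lemma alt_neg X i j l : i != j -> enum_rk2 X i j l ->
  forall k, k \in pred2 i j -> pos X (- act X (alt i j (size l)) (alpha k)).
Proof.
move=> ij [ul el]; have m2 := enum_rk2_ge2 ij (conj ul el).
have g := alt_good ij (conj ul el) (leqnn _).
case e: (size l) (m2) => [//|n] _; rewrite e in g.
have p1 := @good_last X (alt i j n) (letter i j n) ltac:(by rewrite -altS).
rewrite -altS in p1.
have p2 : pos X (- act X (alt i j n.+1) (alpha (letter j i n))).
  have [pp|//] := root_pm (root_act_alpha X (alt i j n.+1) (letter j i n)).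
  have g' : good X (alt i j n.+2).
    by rewrite altS letterS; apply/good_rcons.
  have sub : {subset betas X (alt i j n.+2) <= l}.
    move=> v vb; apply/el; split; first exact: g'.
    exact: rk2_betas (over_alt i j _) vb.
  have := uniq_leq_size (good_uniq g') sub.
  by rewrite size_betas size_alt e ltnn.
have [ni nj] := letter_over (P := fun k => pos X (- act X _ (alpha k))) p1 p2.
by move=> k; rewrite inE => /orP[] /eqP->.
Qed.

(* A simple root cannot be written nontrivially as a nonnegative combination of
   positive roots, so the longest rank two word permutes the two simple roots
   up to sign; the first inversion tells which permutation it is. *)
Lemma alt_longest X i j l : i != j -> enum_rk2 X i j l ->
  act X (alt i j (size l)) (alpha (letter i j (size l))) = - alpha i /\
  act X (alt i j (size l)) (alpha (letter j i (size l))) = - alpha j.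
Proof.
move=> ij hl; have m2 := enum_rk2_ge2 ij hl.
have g := alt_good ij hl (leqnn _); have neg := alt_neg ij hl.
move: (size l) m2 g neg => m m2 g neg.
set p := letter j i m; set q := letter i j m.
have [pin qin] : p \in pred2 i j /\ q \in pred2 i j.
  by rewrite /p /q /letter; case: odd; rewrite !inE !eqxx ?orbT.
have pq : p != q by rewrite /p /q /letter; case: odd => //; rewrite eq_sym.
set f := act X (alt i j m).
have rkpq v : rk2 i j v -> rk2 p q v.
  by rewrite /p /q /letter; case: odd => //; exact: rk2_sym.
have [px py] := (neg p pin, neg q qin); rewrite -/f in px py.
have key k : k \in pred2 i j ->
    alpha k = - f (alpha p) \/ alpha k = - f (alpha q).
  move=> kij; set c := - coact X (alt i j m) (alpha k).
  have rk : rk2 i j (alpha k).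
    by move: kij; rewrite inE => /orP[] /eqP->;
      [exact: rk2_alphal|exact: rk2_alphar].
  have rc : rk2 i j c.
    by move=> z zi zj; rewrite ZlatN (rk2_coact _ (over_alt i j m) rk).
  have kb : alpha k \in betas X (alt i j m).
    have [_ ni] := neg i ltac:(by rewrite inE eqxx).
    have [_ nj] := neg j ltac:(by rewrite inE eqxx orbT).
    exact: (rk2_longest_betas ij (over_alt i j m) g ni nj (alpha_pos X k) rk).
  have [_ nc] := good_neg g kb; rewrite -/c in nc.
  have ek : alpha k = (- f (alpha p)) *~ c p + (- f (alpha q)) *~ c q.
    rewrite !mulNrz -opprD -(act_rk2 _ _ pq (rkpq _ rc)) /c raddfN /= coactK.
    by rewrite opprK.
  have := congr1 height ek.
  rewrite height_alpha raddfD !raddfMz /= !mulrzz.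
  move: (pos_height px) (pos_height py) (nc p) (nc q) ek.
  move: (height _) (height _) (c p) (c q) => hx hy a b hx0 hy0 a0 b0 ek e1.
  have [[ea eb]|[ea eb]] : (a = 1 /\ b = 0) \/ (a = 0 /\ b = 1) by nia.
    by left; rewrite ek ea eb mulr1z mulr0z addr0.
  by right; rewrite ek ea eb mulr1z mulr0z add0r.
have ai_aj : alpha i <> alpha j.
  by move=> /ffunP/(_ i); rewrite !ZlatE eqxx (negPf ij).
have nip : alpha i <> - f (alpha p).
  case: m m2 @p @q @f g {px py pq rkpq key neg pin qin} => [//|[//|m]] _ p q f g.
  rewrite altS in g; rewrite /f /p letterS altS act_rcons srefl_alpha_id.
  rewrite raddfN opprK => e.
  have [{}g _] := (good_rcons _ _ _).1 g.
  have ib : alpha i \in betas X (alt i j m.+1) by rewrite /= mem_head.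
  by have [_] := good_neg g ib; rewrite e actK => /(pos_opp (alpha_pos X _)).
have eiq : alpha i = - f (alpha q).
  by case: (key i ltac:(by rewrite inE eqxx)).
have ejp : alpha j = - f (alpha p).
  by case: (key j ltac:(by rewrite inE eqxx orbT)) => // ejq; rewrite eiq ejq in ai_aj.
by rewrite eiq ejp !opprK.
Qed.

(** * The Coxeter relations *)

Lemma ends_alt X i j (m : nat) : iter m (r i \o r j) X = X ->
  ends X (alt i j m) = ends X (alt j i m).
Proof.
move=> itm.
(* The walk of 2m alternating letters starting with [j] is closed. Starting with [i] instead runs
   along it backwards, so the two walks meet after m letters. *)
have loop : ends X (alt j i m.*2) = X.
  rewrite -[RHS]itm; elim: (m) => [//|n IH].
  by rewrite doubleS !altS !ends_rcons IH /letter /= odd_double.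
suff back (k : nat) : (k <= m.*2)%N -> ends X (alt i j k) = ends X (alt j i (m.*2 - k)).
  by rewrite (back m) -addnn ?leq_addr // addnK.
elim: k => [_|k IH km]; first by rewrite subn0 loop.
rewrite altS ends_rcons (IH (ltnW km)) -(subnSK km) altS ends_rcons.
have -> : letter j i (m.*2 - k.+1) = letter i j k.
  by rewrite /letter oddB // odd_double /=; case: odd.
exact: robj_invol.
Qed.

Lemma enum_rk2_card X i j l : i != j -> enum_rk2 X i j l ->
  (Delta X `&` [set v | exists p q : nat, v = alpha i *+ p + alpha j *+ q]
     #= `I_(size l))%classic%card.
Proof.
move=> ij [ul el].
have -> : (Delta X `&` [set v | exists p q : nat,
    v = alpha i *+ p + alpha j *+ q] = [set` [fset x in l]%fset])%classic.
  apply/seteqP; split=> v /=.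
    move=> [Dv [p [q ev]]]; rewrite inE; apply/el; split.
      split => //; rewrite ev !pmulrn.
      by apply: nonneg_add; apply: nonneg_mulz => //; exact: nonneg_alpha.
    by move=> k ki kj; rewrite ev !pmulrn !ZlatE (negPf ki) (negPf kj) !mul0r.
  rewrite inE => /el[[Dv nv] rv]; split => //; exists `|v i|%N, `|v j|%N.
  by rewrite {1}(rk2_expand ij rv) !pmulrn !gez0_abs.
by apply/card_eq_fsetP; rewrite card_fseq undup_id.
Qed.

Lemma eq_act_alpha X t t' : (forall k, act X t (alpha k) = act X t' (alpha k)) ->
  act X t = act X t'.
Proof.
move=> e; apply/funext => v; rewrite (Zlat_expand v) !raddf_sum /=.
by apply: eq_bigr => k _; rewrite !raddfMz /= e.
Qed.

(** The end objects agree by the axiom, the images of the two simple roots by [alt_longest]. For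
    another [k], the inverse of one map after the other sends alpha_k to alpha_k + c, and with roles
    exchanged to alpha_k - c, with c of rank two. Both are roots with coefficient 1 at [k], hence
    positive, so c = 0. *)
Lemma braid X i j l : i != j -> enum_rk2 X i j l ->
  word C X (alt i j (size l)) = word C X (alt j i (size l)).
Proof.
move=> ij hl; have ji : j != i by rewrite eq_sym.
have hl' := enum_rk2C hl.
have [fq fp] := alt_longest ij hl; have [gp gq] := alt_longest ji hl'.
have e : ends X (alt i j (size l)) = ends X (alt j i (size l)).
  exact: ends_alt (rs_braid RS ij (enum_rk2_card ij hl)).
move: (size l) => m in fp fq gp gq e *.
rewrite !wordE e; congr pair; apply: eq_act_alpha => k.
set f := act X (alt i j m); set g := act X (alt j i m).
have [fgi fgj] : f (alpha i) = g (alpha i) /\ f (alpha j) = g (alpha j).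
  apply: (letter_over (P := fun k => f (alpha k) = g (alpha k)) (n := m)).
    by rewrite /f /g fq gq.
  by rewrite /f /g fp gp.
case: (eqVneq k i) => [->//|ki]; case: (eqVneq k j) => [->//|kj].
set c := coact X (alt i j m) (g (alpha k)) - alpha k.
have ofw : over i j (alt i j m) := over_alt i j m.
have ogw : over i j (alt j i m) by rewrite overC over_alt.
have rc : rk2 i j c.
  move=> z zi zj; rewrite /c ZlatD ZlatN (coact_coord _ _ ofw) //.
  by rewrite (act_coord _ _ ogw) // subrr.
have gk : coact X (alt i j m) (g (alpha k)) = alpha k + c by rewrite addrC subrK.
have fk : coact X (alt j i m) (f (alpha k)) = alpha k - c.
  rewrite -[RHS](actK C X (alt j i m)) raddfB /=; congr coact.
  rewrite (act_rk2 _ _ ij rc) -[act X _ (alpha k)](coactK C X (alt i j m)) -/g gk.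
  by rewrite raddfD /= (act_rk2 _ _ ij rc) -/f -/g fgi fgj addrK.
clearbody c; have rootg : Delta (ends X (alt i j m)) (alpha k + c).
  by rewrite -gk; apply: root_coact; exact: root_act_alpha.
have rootf : Delta (ends X (alt j i m)) (alpha k - c).
  by rewrite -fk; apply: root_coact; exact: root_act_alpha.
have ck : c k = 0 by exact: rc.
have [_ ng] : pos (ends X (alt i j m)) (alpha k + c).
  by apply: (root_pos_coord (k := k)) => //; rewrite !ZlatE eqxx ck.
have [_ nf] : pos (ends X (alt j i m)) (alpha k - c).
  by apply: (root_pos_coord (k := k)) => //; rewrite !ZlatE eqxx ck.
have c0 : c = 0.
  apply/ffunP => z; rewrite Zlat0; case: (eqVneq z k) => [->//|zk].
  have := ng z; have := nf z; rewrite !ZlatE (negPf zk) !add0r oppr_ge0 => a b.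
  by apply/eqP; rewrite eq_le a.
by rewrite -[f _](coactK C X (alt j i m)) fk c0 subr0.
Qed.

(* [v] is a right factor over two letters of maximal length among all
   expressions of the element, so [u] has neither letter as a right descent. *)
Lemma rk2_split X t i j :
  exists u (v : seq I), [/\ word C X t = word C X (u ++ v), size t = (size u + size v)%N,
    over i j v & forall u' k, k \in pred2 i j ->
      word C X u = word C X (rcons u' k) -> size u = (size u').+1 -> False].
Proof.
pose P u (v : seq I) := [/\ word C X t = word C X (u ++ v),
  size t = (size u + size v)%N & over i j v].
suff H (n : nat) u (v : seq I) : (size u <= n)%N -> P u v -> exists u (v : seq I), P u v /\
    forall u' k, k \in pred2 i j ->
      word C X u = word C X (rcons u' k) -> size u = (size u').+1 -> False.
  have [|u [v [[p1 p2 p3] p4]]] := H _ t [::] (leqnn _).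
    by split; rewrite ?cats0 ?addn0.
  by exists u, v.
elim: n u v => [|n IH] u v un pu.
  by exists u, v; split => // u' k _ _ e; rewrite e in un.
have [] := pselect (exists u' k, [/\ k \in pred2 i j,
    word C X u = word C X (rcons u' k) & size u = (size u').+1]); last first.
  move=> ne; exists u, v; split => // u' k ok ew es; apply: ne.
  by exists u', k.
move=> [u' [k [ok ew es]]]; apply: (IH u' (k :: v)).
  by rewrite -ltnS -es.
case: pu => p1 p2 p3; split.
- by rewrite p1 (word_catl _ ew) cat_rcons.
- by rewrite p2 es addSnnS.
- by apply/andP; split.
Qed.

(** * Length equals the number of inversions *)

(** The exchange property. The bound lets it be proved by induction alongside the positivity of the
    roots of shortest words. *)
Definition descent_upto (n : nat) := forall X t i, shortest X t ->
  (size t <= n)%N -> nonneg (- act X t (alpha i)) ->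
  exists2 t', size t = (size t').+1 & word C X t = word C X (rcons t' i).

(** If the next root were negative, [t] could be rewritten to end in [i], and cancelling the two
    letters [i] would shorten the word. *)
Lemma shortest_good_upto n : descent_upto n ->
  forall X t, shortest X t -> (size t <= n.+1)%N -> good X t.
Proof.
move=> D X; elim/last_ind=> [//|t i IH] st; rewrite size_rcons ltnS => tn.
have st' : shortest X t by move: st; rewrite -cats1 => /shortest_catl.
apply/good_rcons; split; first exact: IH st' (leqW tn).
have [//|[_ ni]] := root_pm (root_act_alpha X t i).
have [t' e ew] := D X t i st' tn ni.
have ew' : word C X t' = word C X (rcons t i).
  by rewrite -(word_dup C X t' i) -cats1 -(word_catl _ ew) cats1.
by have := st t' ew'; rewrite size_rcons e; lia.
Qed.

(** As the word ends in [j], the maximal factor [v] is nonempty, so [u] is short enough for the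
    exchange property: a negative image of [alpha i] or [alpha j] would give one more letter to move
    into [v]. *)
Lemma rk2_factor n X t0 i j : descent_upto n ->
  shortest X (rcons t0 j) -> (size t0 <= n)%N ->
  exists u (v : seq I), [/\ word C X (rcons t0 j) = word C X (u ++ v),
    (size t0).+1 = (size u + size v)%N, over i j v & (0 < size v)%N] /\
    [/\ shortest X u, shortest (ends X u) v &
        forall k, k \in pred2 i j -> nonneg (act X u (alpha k))].
Proof.
move=> D st tn; have [u [v [ew es ov umin]]] := rk2_split X (rcons t0 j) i j.
have suv : shortest X (u ++ v) by apply: shortest_eq st; rewrite ?size_cat.
rewrite size_rcons in es; have su := shortest_catl suv.
have v0 : (0 < size v)%N.
  case: v => // in ew es {ov suv} *; exfalso.
  apply: (umin t0 j); first by rewrite inE eqxx orbT.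
    by rewrite ew cats0.
  by rewrite es addn0.
exists u, v; split; split => // [|k kij]; first exact: shortest_catr suv.
have un : (size u <= n)%N by lia.
have [[]//|[_ nk]] := root_pm (root_act_alpha X u k).
by have [u' e ew'] := D X u k su un nk; case: (umin u' k).
Qed.

(** Splitting off a right factor over [i] and the last letter [j] reduces the claim to rank two. If
    the factor does not end in [i], it is the longest one, and the Coxeter relation rewrites it to
    end in [i]. *)
Lemma descent n : descent_upto n.
Proof.
elim: n => [|n D] X t i st tn ni.
  move: tn ni; rewrite leqn0 => /nilP -> /=.
  by move=> /(pos_opp (alpha_pos X i)).
case/lastP: t => [|t0 j] in st tn ni *.
  by have := pos_opp (alpha_pos X i) ni.
case: (eqVneq i j) => [->|ij]; first by exists t0; rewrite ?size_rcons.
rewrite size_rcons ltnS in tn.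
have [u [v [[ew es ov v0] [su sv pu]]]] := rk2_factor i D st tn.
have vn : (size v <= n.+1)%N by lia.
have gv := shortest_good_upto D sv vn.
have nvi : nonneg (- act (ends X u) v (alpha i)).
  have [pi|[]//] := root_pm (root_act_alpha (ends X u) v i).
  exfalso; apply: pos_opp ni.
  have -> : act X (rcons t0 j) = act X (u ++ v).
    by move: ew; rewrite !wordE => -[].
  rewrite act_cat; apply: (pos_act_rk2 ij) pi _.
  - by apply: pu; rewrite inE eqxx.
  - by apply: pu; rewrite inE eqxx orbT.
  - by apply: rk2_act ov _; exact: rk2_alphal.
suff [v' ev ewv] : exists2 v', size v = (size v').+1 &
    word C (ends X u) v = word C (ends X u) (rcons v' i).
  exists (u ++ v'); first by rewrite size_rcons es ev size_cat addnS.
  by rewrite ew (word_catr ewv) rcons_cat.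
case/lastP: v => [//|v k] in ew es ov v0 sv vn gv nvi *.
have := ov; rewrite over_rcons => /andP[kij _].
case: (eqVneq k i) => [->|ki]; first by exists v; rewrite ?size_rcons.
have ekj : k = j by case/orP: kij => /eqP // ki'; rewrite ki' eqxx in ki.
have [_ nvj] := good_last gv; rewrite {2}ekj in nvj.
set w := rcons v k in ew es ov v0 sv vn gv nvi nvj *.
(* Both simple roots are negative under [w], so its roots are all the positive ones of rank two and
   its length is m_ij. *)
have hl : enum_rk2 (ends X u) i j (betas (ends X u) w).
  split=> [|z]; first exact: good_uniq.
  split=> [zw|[pz rz]]; first by split; [exact: gv|exact: rk2_betas zw].
  exact: (rk2_longest_betas ij ov gv nvi nvj).
have := braid ij hl; rewrite size_betas => br.
have {br} [ewi ewj] : word C (ends X u) w = word C (ends X u) (alt i j (size w))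
   /\ word C (ends X u) w = word C (ends X u) (alt j i (size w)).
  by case: (good_over_alt ij ov gv) => ea; split; rewrite {1}ea ?br // -br.
move: v0 ewi ewj; case: (size w) => // m _; rewrite !altS.
(* Parity decides which of the two alternating words ends in [i]. *)
case: (boolP (odd m)) => om.
  rewrite /(letter j) om => _ ewj.
  by exists (alt j i m); rewrite ?size_alt.
rewrite /(letter i) (negPf om) => ewi _.
by exists (alt i j m); rewrite ?size_alt.
Qed.

Lemma shortest_good X t : shortest X t -> good X t.
Proof. by move=> st; exact: shortest_good_upto (@descent _) _ _ st (leqnSn _). Qed.

(** * Decomposition of positive roots *)

(* The shape of a triangulated polygon: a strict local maximum of the height
   is the sum of its two neighbours, and deleting it preserves the three-term
   relations. *)
Lemma interior_decomp (m : nat) (b : nat -> Zlat I) :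
  (forall k : nat, (0 < k < m)%N ->
     exists c : int, b k.-1 + b k.+1 = b k *~ c) ->
  (forall k : nat, (k <= m)%N -> 0 < height (b k)) ->
  height (b 0%N) = 1 -> height (b m) = 1 ->
  (forall k : nat, (0 < k < m)%N -> 1 < height (b k)) ->
  forall k : nat, (0 < k < m)%N ->
  exists p q : nat, [/\ (p <= m)%N, (q <= m)%N & b k = b p + b q].
Proof.
elim: m b => [|m IH] b rel hb h0 hm hi k km; first by lia.
have ex : exists x : nat, (0 < x)%N && (height (b x.+1) <= height (b x)).
  by exists m; rewrite hm; apply/andP; split; [lia|apply/ltW/hi; lia].
case: (ex_minnP ex) => x /andP[x0 hx] xmin.
have xm : (x < m.+1)%N.
  rewrite ltnS; apply: xmin; rewrite hm.
  by apply/andP; split; [lia|apply/ltW/hi; lia].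
have hx' : height (b x.-1) < height (b x).
  case: x => [//|[|x]] in x0 hx xmin xm *; first by rewrite h0; apply: hi; lia.
  rewrite ltNge; apply/negP => hx'.
  by have := xmin x.+1; rewrite hx' /= => /(_ isT); lia.
have ebx : b x = b x.-1 + b x.+1.
  (* Height rises strictly into [x] and does not rise right after it, so the two neighbours together
     have positive height below twice that of [b x]: only c = 1 remains. *)
  have [c ec] := rel x ltac:(lia); rewrite ec.
  have := congr1 height ec; rewrite raddfD raddfMz /= mulrzz => ec'.
  have -> : c = 1; last by rewrite mulr1z.
  have := hb x.-1 ltac:(lia); have := hb x.+1 ltac:(lia).
  move: (height _) (height _) (height _) ec' hx hx' => p q s' *; nia.
case: (eqVneq k x) => [->|kx].
  by exists x.-1, x.+1; split => //; lia.
(* Deleting [b x] lowers by one the coefficient in the relation at each of its interior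
   neighbours. *)
pose b' y := b (bump x y).
have bumplt (y : nat) : (y < x)%N -> bump x y = y by rewrite /bump; lia.
have bumpge (y : nat) : (x <= y)%N -> bump x y = y.+1 by rewrite /bump; lia.
have rel' (y : nat) : (0 < y < m)%N ->
    exists c : int, b' y.-1 + b' y.+1 = b' y *~ c.
  move=> ym; rewrite /b'; have [yx|yx] := ltnP y x.
    have [c ec] := rel y ltac:(lia).
    rewrite (bumplt y) // (bumplt y.-1); last by lia.
    have [yx'|yx'] := ltnP y.+1 x; first by exists c; rewrite bumplt.
    have exy : x = y.+1 by lia.
    exists (c - 1); rewrite bumpge // mulrzBr -ec mulr1z -exy ebx exy /=.
    by rewrite [b y + _]addrC addrA addrK.
  rewrite (bumpge y) // (bumpge y.+1); last by lia.
  have [c ec] := rel y.+1 ltac:(lia).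
  have [yx'|yx'] := ltnP x y; first by exists c; rewrite bumpge ?prednK //; lia.
  have exy : x = y by lia.
  subst y; exists (c - 1); rewrite bumplt; last by lia.
  by rewrite mulrzBr -ec mulr1z /= ebx [RHS]addrAC addrK.
have [|||||p [q [pm qm e]]] := IH b' rel' _ _ _ _ (unbump x k).
- by move=> y ym; apply: hb; rewrite /bump; lia.
- by rewrite /b' bumplt.
- by rewrite /b' bumpge //; lia.
- by move=> y ym; apply: hi; rewrite /bump; lia.
- by rewrite /unbump; lia.
have ek : b k = b' (unbump x k) by rewrite /b' unbumpK.
by exists (bump x p), (bump x q); split; rewrite ?ek // /bump; lia.
Qed.

(** The letter [p] turns alpha_p into its opposite, then [q] adds a multiple of alpha_q. For
    consecutive letters of an alternating word this is the relation that [interior_decomp]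
    requires. *)
Lemma three_term X u p q : exists c : int,
  act X u (alpha p) + act X (rcons (rcons u p) q) (alpha p) =
  act X (rcons u p) (alpha q) *~ c.
Proof.
exists (- cmat C (ends X (rcons u p)) q p).
rewrite [act X (rcons _ q) _]act_rcons srefl_alpha raddfB raddfMz /=.
rewrite [act X (rcons u p) (alpha p)]act_rcons srefl_alpha_id raddfN /=.
by rewrite addrA subrr sub0r mulrNz.
Qed.

(** The longest alternating word lists the positive roots of rank two from alpha_i to alpha_j. Those
    strictly between have height above 1, as roots of height 1 are simple, and [interior_decomp]
    applies. *)
Lemma rk2_decomp X i j l v : i != j -> enum_rk2 X i j l -> v \in l ->
  [\/ v = alpha i, v = alpha j |
      exists x y, [/\ x \in l, y \in l & v = x + y]].
Proof.
move=> ij hl vl; have m2 := enum_rk2_ge2 ij hl.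
have g := alt_good ij hl (leqnn _); have neg := alt_neg ij hl.
have [_ last_j] := alt_longest ij hl.
have [ul el] := hl.
pose b (k : nat) := act X (alt i j k) (alpha (letter i j k)).
have nthb (k : nat) : (k < size l)%N -> b k = nth 0 (betas X (alt i j (size l))) k.
  move=> kl; rewrite (nth_betas _ _ i) ?size_alt // nth_mkseq // /b.
  by rewrite /alt /mkseq -map_take take_iota (minn_idPl (ltnW kl)).
have mem_l w : (w \in l) = (w \in betas X (alt i j (size l))).
  apply/idP/idP => [/el[pw rw]|wb].
    apply: (rk2_longest_betas ij (over_alt i j _) g _ _ pw rw).
      by apply: (neg i _).2; rewrite inE eqxx.
    by apply: (neg j _).2; rewrite inE eqxx orbT.
  by apply/el; split; [exact: g|exact: rk2_betas (over_alt i j _) wb].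
have bl (k : nat) : (k < size l)%N -> b k \in l.
  by move=> kl; rewrite mem_l nthb // mem_nth // size_betas size_alt.
have b_inj (k k' : nat) : (k < size l)%N -> (k' < size l)%N -> b k = b k' -> k = k'.
  move=> kl kl'; rewrite !nthb // => /eqP.
  by rewrite nth_uniq ?size_betas ?size_alt ?good_uniq // => /eqP.
have b0 : b 0%N = alpha i by [].
have bm : b (size l).-1 = alpha j.
  move: last_j; rewrite /b; case: (size l) m2 => // m _.
  by rewrite -pred_Sn letterS altS act_rcons srefl_alpha_id raddfN => /oppr_inj.
have [k kl ev] : exists2 k, (k < size l)%N & v = b k.
  move: vl; rewrite mem_l => /(nthP 0)[k]; rewrite size_betas size_alt => kl <-.
  by exists k; rewrite ?nthb.
have [k0|k0] := posnP k; first by rewrite ev k0 b0; constructor 1.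
have [km|km] := eqVneq k (size l).-1; first by rewrite ev km bm; constructor 2.
constructor 3.
have pb (y : nat) : (y <= (size l).-1)%N -> pos X (b y).
  by move=> yl; have /el[] : b y \in l by apply: bl; lia.
have [||||||p [q [pm qm e]]] := @interior_decomp (size l).-1 b _ _ _ _ _ k.
- by move=> [//|y] _; rewrite -pred_Sn /b !altS !letterS; exact: three_term.
- by move=> y /pb/pos_height.
- by rewrite b0 height_alpha.
- by rewrite bm height_alpha.
- move=> y ym; have py : pos X (b y) by apply: pb; lia.
  suff : height (b y) <> 1.
    by have := pos_height py; move: (height _) => h; lia.
  move=> /(nonneg_height1 py.2)[c ec].
  have /el[_ rc] : b y \in l by apply: bl; lia.
  have := rc c; rewrite ec ZlatE eqxx; case: (eqVneq c i) => [ci _|ci].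
    by have := b_inj y 0%N ltac:(lia) ltac:(lia); rewrite ec ci b0 => /(_ erefl); lia.
  have kl' : ((size l).-1 < size l)%N by lia.
  case: (eqVneq c j) => [cj _|cj /(_ isT isT)//].
  by have := b_inj y _ ltac:(lia) kl'; rewrite ec cj bm => /(_ erefl); lia.
- by lia.
by exists (b p), (b q); rewrite ev; split => //; apply: bl; lia.
Qed.

(** * Positive roots as simple roots or sums of two positive roots *)

Definition inversions_all X t := forall v, pos X v -> v \in betas X t.

Definition simple_or_sum X v :=
  (exists i, v = alpha i) \/ exists x y, [/\ pos X x, pos X y & v = x + y].

Hypothesis fin_pos : forall X, exists l : seq (Zlat I),
  forall v, pos X v <-> v \in l.

Lemma enum_rk2_exists X i j : exists l, enum_rk2 X i j l.
Proof.
have [l hl] := fin_pos X.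
exists (undup [seq v <- l | `[< rk2 i j v >]]); split; first exact: undup_uniq.
move=> v; rewrite mem_undup mem_filter; split=> [/andP[/asboolP rv /hl]|] //.
by move=> [/hl vl rv]; rewrite vl asboolT.
Qed.

(** Split off a right factor [v] over [k] and the last letter. If the rank two root v alpha_k is
    simple, induction applies to the shorter [u]; if it is a sum x + y, then u x + u y is the sum
    sought. *)
Lemma good_decomp_upto n X t k : (size t <= n)%N -> good X t ->
  pos X (act X t (alpha k)) -> simple_or_sum X (act X t (alpha k)).
Proof.
elim: n X t k => [|n IH] X t k.
  by rewrite leqn0 => /nilP-> _ _; left; exists k.
case/lastP: t => [|t j] tn g pk; first by left; exists k.
rewrite size_rcons ltnS in tn.
have kj : k != j.
  by apply/eqP => kj; have [_] := good_last g; rewrite -{2}kj => /(pos_opp pk).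
have [u [v [[ew es ov v0] [su sv pu]]]] :=
  rk2_factor k (@descent n) (good_shortest g) tn.
have eact : act X (rcons t j) = act X (u ++ v) by move: ew; rewrite !wordE => -[].
move: pk; rewrite eact act_cat => pk.
have nuk : nonneg (act X u (alpha k)) by apply: pu; rewrite inE eqxx.
have nuj : nonneg (act X u (alpha j)) by apply: pu; rewrite inE eqxx orbT.
have rv : rk2 k j (act (ends X u) v (alpha k)) by apply: rk2_act ov _; exact: rk2_alphal.
have pv : pos (ends X u) (act (ends X u) v (alpha k)).
  have [//|pn] := root_pm (root_act_alpha (ends X u) v k).
  have rnv : rk2 k j (- act (ends X u) v (alpha k)).
    by move=> z zk zj; rewrite ZlatN rv.
  have [_] := pos_act_rk2 kj nuk nuj pn rnv.
  by rewrite raddfN => /(pos_opp pk).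
have [l hl] := enum_rk2_exists (ends X u) k j.
have un : (size u <= n)%N by lia.
have gu := shortest_good su.
have [e|e|[x [y [/hl.2[px rx] /hl.2[py ry] e]]]] :=
    rk2_decomp kj hl ((hl.2 _).2 (conj pv rv)).
- by move: pk; rewrite e; exact: IH.
- by move: pk; rewrite e; exact: IH.
right; exists (act X u x), (act X u y).
by split; rewrite ?e ?raddfD //; exact: (pos_act_rk2 kj).
Qed.

Lemma all_neg_inversions_all X t : good X t ->
  (forall i, nonneg (- act X t (alpha i))) -> inversions_all X t.
Proof.
move=> g neg v pv; apply: (good_betas_neg g pv).
have [[_ nx]|//] := root_pm (root_coact t pv.1).
case: (pos_opp pv); rewrite -[v](coactK C X t) [coact _ _ _]Zlat_expand.
rewrite raddf_sum -sumrN => z; rewrite sum_ffunE; apply: sumr_ge0 => i _.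
by rewrite raddfMz -mulNrz /=; exact: nonneg_mulz.
Qed.

(** Letters are added while some simple root has a positive image. The roots of the word are
    distinct and positive, so this stops. *)
Lemma longest_exists X : exists2 t, good X t & inversions_all X t.
Proof.
have [l hl] := fin_pos X.
suff [[t [g st]]|//] : (exists t, good X t /\ size t = (size l).+1) \/
    exists2 t, good X t & inversions_all X t.
  have := uniq_leq_size (good_uniq g) (fun v vt => (hl v).1 (g v vt)).
  by rewrite size_betas st ltnn.
elim: (size l).+1 => [|n [[t [g st]]|]]; [by left; exists [::]| |by right].
have [[i pi]|npi] := pselect (exists i, pos X (act X t (alpha i))).
  by left; exists (rcons t i); rewrite size_rcons st; split => //; exact/good_rcons.
right; exists t => //; apply: all_neg_inversions_all g _ => i.
have [pi|[]//] := root_pm (root_act_alpha X t i).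
by case: npi; exists i.
Qed.

Lemma pos_real X v : pos X v -> exists t i, good X t /\ v = act X t (alpha i).
Proof.
move=> pv; have [t g inv] := longest_exists X.
have /(nthP 0)[k] := inv v pv; rewrite size_betas => kt <-.
have [i0 _] : exists i0 : I, true by case: t kt {g inv} => // i0 *; exists i0.
exists (take k t), (nth i0 t k); rewrite (nth_betas _ _ i0) //; split => //.
by apply: (@good_catl _ _ (drop k t)); rewrite cat_take_drop.
Qed.

Lemma pos_simple_or_sum X v : pos X v -> simple_or_sum X v.
Proof.
by move=> pv; move: pv (pv) => /pos_real[t [i [g ->]]]; exact: good_decomp_upto g.
Qed.

(** Pulled back to a simple root, [v] has a coordinate equal to 1, which is odd. *)
Lemma pos_not_double X v x : pos X v -> v <> x + x.
Proof.
move=> /pos_real[t [i [_ ->]]] /(congr1 (coact X t)).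
rewrite actK raddfD /= => /ffunP/(_ i); rewrite !ZlatE eqxx /=.
by move: (coact _ _ _ _) => z; lia.
Qed.

(** * Convex orders *)

Section Order.
Variables (X : obj) (le : rel (Zlat I)).
Hypothesis hle : total_order_on (pos X) le.
Implicit Types (l : seq (Zlat I)).

Lemma pos_le_refl v : pos X v -> le v v.
Proof. by case: hle => h _ _ _ pv; apply: h; exact: mem_set. Qed.

Lemma pos_le_anti v w : pos X v -> pos X w -> le v w -> le w v -> v = w.
Proof.
case: hle => _ h _ _ pv pw vw wv.
by apply: h; rewrite ?vw ?wv //; exact: mem_set.
Qed.

Lemma pos_le_trans w v z : pos X v -> pos X w -> pos X z ->
  le v w -> le w z -> le v z.
Proof. by case: hle => _ _ h _ pv pw pz; apply: h; exact: mem_set. Qed.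

Lemma pos_le_total v w : pos X v -> pos X w -> le v w \/ le w v.
Proof. by case: hle => _ _ _ h pv pw; apply/orP; apply: h; exact: mem_set. Qed.

Lemma pos_min l : (0 < size l)%N -> (forall v, v \in l -> pos X v) ->
  exists2 w, w \in l & forall v, v \in l -> le w v.
Proof.
elim: l => [//|a [|b l] IH] _ pl.
  by exists a; rewrite ?mem_head // => v; rewrite inE => /eqP->;
    apply: pos_le_refl; apply: pl; rewrite mem_head.
have [|w wl hw] := IH isT; first by move=> v vl; apply: pl; rewrite inE vl orbT.
have [pa pw] : pos X a /\ pos X w by split; apply: pl; rewrite inE ?eqxx ?wl ?orbT.
have [aw|wa] := pos_le_total pa pw.
  exists a; first by rewrite mem_head.
  move=> v vl; have pv := pl _ vl; move: vl; rewrite inE => /predU1P[->|/hw].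
    exact: pos_le_refl.
  exact: pos_le_trans.
exists w; first by rewrite inE wl orbT.
by move=> v; rewrite inE => /predU1P[->|/hw].
Qed.

Lemma sorted_head a l : (forall v, v \in a :: l -> pos X v) ->
  sorted le (a :: l) -> forall v, v \in a :: l -> le a v.
Proof.
elim: l a => [|b l IH] a pl /=.
  move=> _ v; rewrite inE => /eqP->; apply: pos_le_refl; apply: pl.
  by rewrite mem_head.
move=> /andP[ab bl] v vl; have pv := pl _ vl.
have pa : pos X a by apply: pl; rewrite mem_head.
have pb : pos X b by apply: pl; rewrite !inE eqxx orbT.
move: vl; rewrite inE => /predU1P[->|vl]; first exact: pos_le_refl.
apply: pos_le_trans ab _ => //; apply: IH bl _ vl => z zl.
by apply: pl; rewrite inE zl orbT.
Qed.

Lemma sorted_last a l : (forall v, v \in a :: l -> pos X v) ->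
  sorted le (a :: l) -> forall v, v \in a :: l -> le v (last a l).
Proof.
elim: l a => [|b l IH] a pl srt v vl.
  by move: (vl); rewrite inE => /eqP->; apply: pos_le_refl; apply: pl; rewrite mem_head.
have {srt} /andP[ab bl] : le a b && sorted le (b :: l) by [].
have pl' z : z \in b :: l -> pos X z by move=> zl; apply: pl; rewrite inE zl orbT.
have pv := pl _ vl; move: vl; rewrite inE => /predU1P[->|]; last exact: IH.
apply: (pos_le_trans (w := b)) => //.
- by apply: pl; rewrite mem_head.
- by apply: pl'; rewrite mem_head.
- by apply: pl'; rewrite /= mem_last.
- exact: (IH b pl' bl b (mem_head _ _)).
Qed.

Lemma nonneg_sum l : (forall v, v \in l -> nonneg v) -> nonneg (\sum_(v <- l) v).
Proof.
move=> nl k; rewrite sum_ffunE big_seq; apply: sumr_ge0 => v vl; exact: nl.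
Qed.

Lemma height_sum_gt0 a l : (forall v, v \in a :: l -> pos X v) ->
  0 < height (\sum_(v <- a :: l) v).
Proof.
move=> pl; rewrite big_cons raddfD /=; apply: ltr_wpDr.
  apply: nonneg_height; apply: nonneg_sum => v vl.
  by apply: (pl v _).2; rewrite inE vl orbT.
by apply: (pos_height (pl a _)); rewrite mem_head.
Qed.

(** * From a reduced expression to strong convexity *)

Lemma nth_beta (m : nat) (t : m.-tuple I) (k : 'I_m) :
  beta C X t k = nth 0 (betas X t) k.
Proof.
have i0 := tnth t k.
by rewrite /beta (nth_betas _ _ i0) ?size_tuple // wordE (tnth_nth i0).
Qed.

Lemma reduced_strongly_convex :
  from_reduced_longest C Delta X le -> strongly_convex_order (pos X) le.
Proof.
move=> [m [t [_ _ epos lt_beta]]].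
have in_betas v : pos X v -> v \in betas X t.
  by rewrite epos => -[k _ <-]; rewrite nth_beta mem_nth // size_betas size_tuple.
have g : good X t.
  move=> v /(nthP 0)[k]; rewrite size_betas size_tuple => km <-.
  by rewrite epos; exists (Ordinal km) => //; rewrite nth_beta.
have idx v : pos X v -> (index v (betas X t) < m)%N.
  by move=> /in_betas vt; rewrite -index_mem size_betas size_tuple in vt.
have idx_slt v w : pos X v -> pos X w ->
    (index v (betas X t) < index w (betas X t))%N -> slt le v w.
  move=> pv pw vw; have := lt_beta (Ordinal (idx v pv)) (Ordinal (idx w pw)) vw.
  by rewrite !nth_beta /= !nth_index ?in_betas.
have idx_le v w : pos X v -> pos X w -> le v w ->
    (index v (betas X t) <= index w (betas X t))%N.
  move=> pv pw vw; rewrite leqNgt; apply/negP => /(idx_slt _ _ pw pv) /andP[ne wv].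
  by rewrite (pos_le_anti pv pw vw wv) eqxx in ne.
have neq v w : pos X v -> pos X w -> v <> w ->
    index v (betas X t) <> index w (betas X t).
  by move=> /in_betas vt /in_betas wt vw e; apply: vw;
    rewrite -(nth_index 0 vt) e nth_index.
have g_take (k : nat) : good X (take k t).
  by apply: (@good_catl _ _ (drop k t)); rewrite cat_take_drop.
have mem_take v (k : nat) : pos X v ->
    (v \in betas X (take k t)) = (index v (betas X t) < k)%N.
  by move=> /in_betas vt; rewrite betas_take in_take.
case=> [//|a [//|b l]] _ hp srt; set sum := \sum_(x <- _) x => psum.
have pl v : v \in [:: a, b & l] -> pos X v by move=> /hp.
have pa : pos X a by apply: pl; rewrite mem_head.
have pz : pos X (last b l) by apply: pl; rewrite inE mem_last orbT.
have hb : 0 < height (\sum_(v <- b :: l) v).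
  by apply: height_sum_gt0 => v vl; apply: pl; rewrite inE vl orbT.
split=> /=.
  have ne : a <> sum.
    rewrite /sum big_cons => /(congr1 height)/eqP; rewrite raddfD /=.
    by rewrite -subr_eq0 opprD addNKr oppr_eq0 gt_eqF.
  apply: idx_slt => //; rewrite ltn_neqAle; apply/andP; split.
    by apply/eqP; exact: neq.
  (* The prefix before [a] keeps every summand positive, so it cannot make the sum negative. *)
  rewrite leqNgt -mem_take //; apply/negP => /(good_neg (g_take _)).
  set c := coact X _ => nc.
  apply: (pos_opp nc); rewrite opprK /sum /c raddf_sum /= -(big_map c xpredT id).
  apply: nonneg_sum => w /mapP[v vl ->].
  have pv := pl v vl; apply: (good_coact_pos (g_take _) pv _).2.
  by rewrite mem_take // -leqNgt idx_le //; exact: (sorted_head pl srt vl).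
have ne : sum <> last b l.
  rewrite /sum lastI big_rcons /= => /(congr1 height)/eqP; rewrite raddfD /=.
  by rewrite -subr_eq0 addrK gt_eqF // height_sum_gt0 // => v vl;
    apply: pl; rewrite lastI mem_rcons inE vl orbT.
apply: idx_slt => //; rewrite ltn_neqAle; apply/andP; split.
  by apply/eqP; exact: neq.
(* This prefix includes the letter of the last summand, so it makes every summand negative, and with
   them the sum. *)
rewrite -ltnS -mem_take //; apply: (good_betas_neg (g_take _) psum).
split; first exact: root_opp (root_coact _ psum.1).
set c := coact X _.
rewrite /sum /c raddf_sum /= -sumrN -(big_map (fun v => - c v) xpredT id).
apply: nonneg_sum => w /mapP[v vl ->].
have pv := pl v vl; apply: (good_neg (g_take _) _).2.
by rewrite mem_take // ltnS idx_le //; exact: (sorted_last pl srt vl).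
Qed.

Lemma strongly_convex_convex :
  strongly_convex_order (pos X) le -> convex_order (pos X) le.
Proof.
move=> sc v w pv pw /andP[_ vw] pvw.
have := sc [:: v; w]; rewrite /= big_cons big_seq1 vw; apply=> //.
by move=> z; rewrite !inE => /orP[] /eqP->.
Qed.

(** * From convexity to a reduced expression *)

Definition initial_segment t := [/\ good X t, pairwise (slt le) (betas X t) &
  forall v w, v \in betas X t -> pos X w -> w \notin betas X t -> slt le v w].

Lemma convex_min_simple t w : convex_order (pos X) le -> initial_segment t ->
  pos X w -> w \notin betas X t ->
  (forall v, pos X v -> v \notin betas X t -> le w v) ->
  exists i, w = act X t (alpha i).
Proof.
move=> cv [g _ iseg] pw wt wmin; have px := good_coact_pos g pw wt.
have [[i e]|[x [y [px' py' e]]]] := pos_simple_or_sum px.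
  by exists i; rewrite -e coactK.
exfalso; have {}e : w = act X t x + act X t y by rewrite -raddfD /= -e coactK.
(* The image of a positive root is either a remaining root or the opposite of a listed one. *)
have sgn z : pos (ends X t) z ->
    (pos X (act X t z) /\ act X t z \notin betas X t) \/ - act X t z \in betas X t.
  move=> pz; have [pz'|pz'] := root_pm (root_act pz.1).
    left; split => //; apply/negP => /(good_neg g); rewrite actK => -[_].
    exact: (pos_opp pz).
  by right; apply: (good_betas_neg g pz'); rewrite raddfN opprK /= actK.
have both a b : w = a + b -> pos X a -> a \notin betas X t -> pos X b ->
    b \notin betas X t -> a <> b -> slt le a b -> False.
  move=> ew pa at' pb bt ab lab; rewrite ew in pw wmin.
  have [/andP[ne l1] _] := cv a b pa pb lab pw.
  by move/eqP: ne; apply; exact: pos_le_anti pa pw l1 (wmin a pa at').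
(* Here -b is listed, hence below w, and -b + w = a is a root: convexity puts it strictly below w,
   against the minimality of w. *)
have mixed a b : w = a + b -> pos X a -> a \notin betas X t ->
    - b \in betas X t -> False.
  move=> ew pa at' bt; have pb := g _ bt.
  have ea : - b + w = a by rewrite ew [a + b]addrC addKr.
  have pa' : pos X (- b + w) by rewrite ea.
  have [_] := cv (- b) w pb pw (iseg _ _ bt pw wt) pa'.
  rewrite ea => /andP[/eqP aw law]; apply: aw.
  exact: pos_le_anti law (wmin a pa at').
have [[pa at'] | at'] := sgn x px'; have [[pb bt] | bt] := sgn y py'.
(* Convexity only compares distinct summands; equal ones would make w a double. *)
- have [eab|/eqP ab] := eqVneq (act X t x) (act X t y).
    by apply: (pos_not_double pw); rewrite e -eab.
  have [lab|lba] := pos_le_total pa pb.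
    by apply: (both _ _ e) => //; rewrite /slt lab andbT; exact/eqP.
  have e' : w = act X t y + act X t x by rewrite addrC.
  apply: (both _ _ e') => //; first exact: nesym.
  by rewrite /slt lba andbT; apply/eqP; exact: nesym.
- exact: (mixed _ _ e).
- by apply: (mixed (act X t y) (act X t x)); rewrite // addrC.
- apply: (pos_opp pw); rewrite e opprD.
  by apply: nonneg_add; [case: (g _ at')|case: (g _ bt)].
Qed.

(** Append the letter of the least remaining root until none remains. A word with more letters than
    [l] has entries cannot be good, which bounds the process. *)
Lemma initial_segment_all : convex_order (pos X) le ->
  exists2 t, initial_segment t & inversions_all X t.
Proof.
move=> cv; have [l hl] := fin_pos X.
suff [[t [[g _ _] st]]|//] : (exists t, initial_segment t /\ size t = (size l).+1) \/
    exists2 t, initial_segment t & inversions_all X t.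
  have := uniq_leq_size (good_uniq g) (fun v vt => (hl v).1 (g v vt)).
  by rewrite size_betas st ltnn.
elim: (size l).+1 => [|n [[t [ist st]]|]]; [by left; exists [::]| |by right].
set rest := [seq w <- l | w \notin betas X t].
have mem_rest w : w \in rest <-> pos X w /\ w \notin betas X t.
  by rewrite mem_filter; split=> [/andP[-> /hl]|[/hl -> ->]].
case: (posnP (size rest)) => [r0|r0].
  right; exists t => // v pv; apply/negPn/negP => vt.
  by have /mem_rest := conj pv vt; rewrite (size0nil r0).
have [|w /mem_rest[pw wt] wmin] := pos_min r0; first by move=> v /mem_rest[].
have {}wmin v : pos X v -> v \notin betas X t -> le w v.
  by move=> pv vt; apply: wmin; apply/mem_rest.
have [i ew] := convex_min_simple cv ist pw wt wmin.
case: ist => g pw_t iseg.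
left; exists (rcons t i); rewrite size_rcons st; split => //.
have mem_b z : z \in betas X (rcons t i) = (z == w) || (z \in betas X t).
  by rewrite betas_rcons mem_rcons inE ew.
split; first by apply/good_rcons; rewrite -ew.
  rewrite betas_rcons pairwise_rcons pw_t andbT -ew.
  by apply/allP => v vt; exact: iseg.
move=> v z; rewrite !mem_b negb_or => /predU1P[->|vt] pz /andP[zw zt].
  by rewrite /slt eq_sym zw wmin.
exact: iseg.
Qed.

(** For maximality, a reduced expression of any other element has distinct positive roots, all among
    those of [t], hence no more letters. *)
Lemma convex_reduced :
  convex_order (pos X) le -> from_reduced_longest C Delta X le.
Proof.
move=> /initial_segment_all[t [g pwt _] inv].
have len : has_length C X (word C X t) (size t).
  by split; [exists t|exact: good_shortest].
exists (size t), (in_tuple t); split => //=.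
- split; first by rewrite /homW /=; exact: word_hom.
  exists (size t) => // w n _ [[t' [<- ew]] wmin].
  have g' : good X t' by apply: shortest_good => u; rewrite ew => /wmin.
  rewrite -(size_betas C X t') -(size_betas C X t).
  by apply: uniq_leq_size (good_uniq g') _ => v /g'/inv.
- apply/seteqP; split=> v /=.
    move=> /inv/(nthP 0)[k]; rewrite size_betas => kt <-.
    by exists (Ordinal kt) => //; rewrite nth_beta.
  by move=> [k _ <-]; apply: g; rewrite nth_beta mem_nth // size_betas.
- move=> j k jk; rewrite !nth_beta.
  by apply: (pairwiseP 0 pwt); rewrite // inE size_betas.
Qed.

End Order.

End RootSystem.

(** * Finiteness at every object, and the equivalence *)

Lemma finite_pos_roots (I : finType) (obj : Type) (C : cartan_scheme I obj)
    (Delta : obj -> set (Zlat I)) :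
  finite_root_system C Delta -> connected_groupoid C ->
  forall X, exists l : seq (Zlat I), forall v, pos_roots Delta X v <-> v \in l.
Proof.
move=> [RS [X0 fin0]] conn X; have [f homf] := conn X X0; have [t e] := hom_word homf.
have eX : X0 = ends C X t by move: e; rewrite wordE => -[].
have : finite_set (pos_roots Delta X).
  (* The word given by connectedness carries the finitely many roots at [X0] onto a set containing
     the positive roots at [X]. *)
  apply: sub_finite_set (finite_image (act C X t) fin0) => v [Dv _].
  exists (coact C X t v); last exact: coactK.
  by rewrite eX; exact: (root_coact RS).
by move=> /finite_seqP[l el]; exists l => v; rewrite el.
Qed.

Theorem theorem2p11 (I : finType) (obj : Type) (C : cartan_scheme I obj)
    (Delta : obj -> set (Zlat I)) (hfin : finite_root_system C Delta)
    (hconn : connected_groupoid C) (X : obj) (le : rel (Zlat I))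
    (hle : total_order_on (pos_roots Delta X) le) :
  [<-> from_reduced_longest C Delta X le;
       strongly_convex_order (pos_roots Delta X) le;
       convex_order (pos_roots Delta X) le].
Proof.
have [RS _] := hfin; have fin := finite_pos_roots hfin hconn.
tfae.
- exact: (reduced_strongly_convex RS hle).
- exact: strongly_convex_convex.
- exact: (convex_reduced RS fin hle).
Qed.
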